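(* Let $H$ be a closed subgroup of a compact group $G$, let $K=H\cap Z(G)$ and $n\ge1$. Then $d^{(n+1)}(H,G)\le\frac12\big(1+d^{(n)}(H/K)\big)$.
   Context: For a compact group $X$, $\mu_X$ denotes its normalized Haar measure and $\mu_X^m$ the product measure on $X^m$; $H/K$ is a compact group with its normalized Haar measure. $Z(G)$ is the center of $G$. Commutators: $[x,y]=x^{-1}y^{-1}xy$, $[x_1]=x_1$, $[x_1,\dots,x_{k+1}]=[[x_1,\dots,x_k],x_{k+1}]$. For a compact group $X$ and $n\ge1$, $d^{(n)}(X)=\mu_X^{n+1}(\{(x_1,\dots,x_{n+1})\in X^{n+1}: [x_1,\dots,x_{n+1}]=1\})$. For a closed subgroup $H$ of $G$ and $m\ge1$, $d^{(m)}(H,G)=(\mu_H^m\times\mu_G)(\{(h_1,\dots,h_m,g)\in H^m\times G: [h_1,\dots,h_m,g]=1\})$. *)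

(* Defs.v *)
From HB Require Import structures.
From mathcomp Require Import all_boot all_order all_algebra.
From mathcomp Require Import all_classical all_reals all_analysis.
Set Implicit Arguments. Unset Strict Implicit. Unset Printing Implicit Defensive.
Import Order.TTheory GRing.Theory Num.Theory.
Local Open Scope classical_set_scope.
Local Open Scope ring_scope.

Definition group_laws (T : Type) (mul : T -> T -> T) (inv : T -> T) (one : T) :=
  [/\ forall x y z, mul x (mul y z) = mul (mul x y) z,
      forall x, mul one x = x,
      forall x, mul x one = x,
      forall x, mul (inv x) x = one &
      forall x, mul x (inv x) = one].

Definition topological_group (T : topologicalType)
    (mul : T -> T -> T) (inv : T -> T) (one : T) :=
  group_laws mul inv one /\
  continuous (fun p : T * T => mul p.1 p.2) /\ continuous inv.

Definition compact_group (T : topologicalType)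
    (mul : T -> T -> T) (inv : T -> T) (one : T) :=
  [/\ topological_group mul inv one, compact [set: T] & hausdorff_space T].

Definition closed_subgroup (T : topologicalType)
    (mul : T -> T -> T) (inv : T -> T) (one : T) (H : set T) :=
  [/\ closed H, H one & forall x y, H x -> H y -> H (mul x (inv y))].

Definition group_center (T : Type) (mul : T -> T -> T) : set T :=
  [set z | forall g, mul z g = mul g z].

Definition comm (T : Type) (mul : T -> T -> T) (inv : T -> T) (x y : T) : T :=
  mul (mul (inv x) (inv y)) (mul x y).

Definition lcomm (T : Type) (mul : T -> T -> T) (inv : T -> T) (one : T)
    (s : seq T) : T :=
  match s with
  | [::] => one
  | x :: r => foldl (comm mul inv) x r
  end.

Definition tcomm (T : Type) (mul : T -> T -> T) (inv : T -> T) (one : T)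
    (k : nat) (x : 'I_k -> T) : T :=
  lcomm mul inv one (map x (enum 'I_k)).

Definition tmul (T : Type) (mul : T -> T -> T) (k : nat)
    (x y : 'I_k -> T) : 'I_k -> T := fun i => mul (x i) (y i).

Definition borel (T : topologicalType) : set (set T) := <<s open >>.

(* [mu] is the normalized Haar measure of the compact group [S], where [S] is a
   closed subgroup of the compact group [T] (the ambient space in which it is
   represented): a Radon (outer regular on Borel sets, inner regular by compact
   sets on open sets) countably additive Borel probability measure on T,
   concentrated on S, invariant under left translations by elements of S.
   (Borel sets/open sets/compact sets of the closed subspace S are the traces
   on S of those of T, so this is exactly the Haar measure of S.) *)
Definition haar_measure (R : realType) (T : topologicalType)
    (mul : T -> T -> T) (S : set T) (mu : set T -> \bar R) : Prop :=
  [/\ mu set0 = 0%E,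
      (forall A, borel A -> (0 <= mu A)%E) /\
      (forall F : nat -> set T, (forall i, borel (F i)) -> trivIset setT F ->
         (fun n => (\sum_(0 <= i < n) mu (F i))%E) @ \oo --> mu (\bigcup_i F i)),
      mu setT = 1%E /\ mu S = 1%E,
      (forall s A, S s -> borel A -> mu [set mul s a | a in A] = mu A) &
      ((forall A, borel A ->
         mu A = ereal_inf [set mu U | U in [set U | open U /\ A `<=` U]]) /\
      (forall U, open U ->
         mu U = ereal_sup [set mu C | C in [set C | compact C /\ C `<=` U]]))].

(* Main.v *)
Require Import Defs.
From HB Require Import structures.
From mathcomp Require Import all_boot all_order all_algebra.
From mathcomp Require Import all_classical all_reals all_analysis.
From mathcomp Require Import lra.
Set Implicit Arguments.
Unset Strict Implicit.
Unset Printing Implicit Defensive.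
Import Order.TTheory GRing.Theory Num.Theory.
Local Open Scope classical_set_scope.
Local Open Scope ring_scope.

(**
Write [c] for the commutator of the first [n+1] coordinates, [E] for the set
where [[c, x_(n+1)] = 1] and [A] for the set where [c] is central.

Off [A] the fibres of [E] are centralizers of noncentral elements, hence of
measure at most 1/2. To avoid Fubini, fix [g] in [G]: on the open set [B_g]
where [c] does not commute with [g], left translation by [(1, .., 1, g)] moves
[E] off itself, so [E] fills at most half of [B_g], and also at most half of
any finite union of the [B_g]. These sets cover the complement of [A], which by
inner regularity is exhausted up to epsilon by finitely many of them. Hence
[mu E <= (1 + mu A) / 2].

It remains to bound [mu A], which is the pushforward of [mu] to [(H/K)^(n+1)]
evaluated at the closed set [C] of tuples with trivial commutator, by [muQ C].
Uniqueness of Haar measure is replaced by double counting: if [nu] and [muQ] are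
left invariant, [W] is an open neighbourhood of [C] and [V] one of [1] with
[V C] inside [W], then partitioning the group into finitely many pieces
contained in translates of [V] and counting the pairs [(x, y)] with [x^-1 y] in
[C] gives [nu (C^-1) <= muQ W]. Outer regularity yields [nu (C^-1) <= muQ C],
and applying this twice (with [nu] and with [muQ] itself) gives [nu C <= muQ C].
*)

(** * Finitely additive set functions *)

Section finite_content.
Context {R : realType} {T : Type}.
Implicit Types (M : set (set T)) (m : set T -> R) (A B : set T).

(** A finitely additive content on an algebra of sets. Splitting [A] along an arbitrary [B] replaces
    additivity on disjoint unions. *)
Definition finite_content M m : Prop :=
  [/\ M setT, setI_closed M, setD_closed M, (forall A, M A -> 0 <= m A) &
      forall A B, M A -> M B -> m A = m (A `&` B) + m (A `\` B)].

Variables (M : set (set T)) (m : set T -> R).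
Hypothesis mM : finite_content M m.

Lemma content_set0 : m set0 = 0.
Proof.
case: mM => MT _ _ _ /(_ _ _ MT MT); rewrite setIT setDv => e.
by apply: (@addrI _ (m setT)); rewrite addr0.
Qed.

Lemma content_le A B : M A -> M B -> A `<=` B -> m A <= m B.
Proof.
case: mM => _ _ MD m0 mD MA MB /setIidr AB.
by rewrite (mD B A) // AB lerDl m0 //; exact: MD.
Qed.

Lemma content_setC A : M A -> m (~` A) = m setT - m A.
Proof.
case: mM => MT _ _ _ mD MA.
by rewrite (mD setT A) // setTI setTD addrAC subrr add0r.
Qed.

(* The right-hand side is the integral over [D] of the simple function given by
   the weighted sets [l]. *)
Lemma content_simple_ge {I : Type} (A : I -> set T) (l : seq (R * I)) (c : R)
    (D : set T) : (forall i, M (A i)) -> M D ->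
  (forall y, D y -> c <= \sum_(p <- l) p.1 * \1_(A p.2) y) ->
  c * m D <= \sum_(p <- l) p.1 * m (A p.2 `&` D).
Proof.
case: (mM) => _ MI MD m0 mD MA.
elim: l c D => [|p l IH] c D hD le_c.
  rewrite big_nil; have [->|/set0P[y Dy]] := eqVneq D set0.
    by rewrite content_set0 mulr0.
  by rewrite mulr_le0_ge0 ?m0 //; have := le_c y Dy; rewrite big_nil.
rewrite big_cons.
(* On [A p.2] the head supplies [p.1], so the tail only has to reach [c - p.1]; off it the tail
   alone must reach [c]. *)
have h1 := IH (c - p.1) (D `&` A p.2) (MI _ _ hD (MA _)).
have h2 := IH c (D `\` A p.2) (MD _ _ hD (MA _)).
have -> : \sum_(q <- l) q.1 * m (A q.2 `&` D) =
    \sum_(q <- l) q.1 * m (A q.2 `&` (D `&` A p.2)) +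
    \sum_(q <- l) q.1 * m (A q.2 `&` (D `\` A p.2)).
  rewrite -big_split; apply: eq_bigr => q _ /=.
  by rewrite -mulrDr (mD _ (A p.2)) ?setIA ?setIDA //; exact: MI.
rewrite (mD D (A p.2)) // [A p.2 `&` D]setIC.
have {}h1 : (c - p.1) * m (D `&` A p.2) <=
    \sum_(q <- l) q.1 * m (A q.2 `&` (D `&` A p.2)).
  apply: h1 => y [Dy Ay]; have := le_c y Dy.
  by rewrite big_cons indicE mem_set // mulr1 -lerBlDl.
have {}h2 : c * m (D `\` A p.2) <=
    \sum_(q <- l) q.1 * m (A q.2 `&` (D `\` A p.2)).
  apply: h2 => y [Dy Ay]; have := le_c y Dy.
  by rewrite big_cons indicE memNset // mulr0 add0r.
lra.
Qed.

(* The weights are the contents of the pieces of the partition of [E] that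
   refines the cover [F]. *)
Lemma content_cover_weights {I : eqType} {Y : Type} (F : I -> set T)
    (A : I -> set Y) (S : Y -> set T) (s : seq I) (E : set T) :
  (forall i, M (F i)) -> (forall y, M (S y)) -> M E ->
  (forall i x y, F i x -> S y x -> A i y) ->
  (forall x, E x -> exists2 i, i \in s & F i x) ->
  exists l : seq (R * I), \sum_(p <- l) p.1 = m E /\
    forall y, m (E `&` S y) <= \sum_(p <- l) p.1 * \1_(A p.2) y.
Proof.
case: (mM) => _ MI MD m0 mD MF MS + FSA.
elim: s E => [|i s IH] E ME EF.
  exists [::]; rewrite big_nil (_ : E = set0); last first.
    by rewrite -subset0 => x /EF[].
  by split=> [|y]; rewrite ?big_nil ?set0I content_set0.
have MEF := MI _ _ ME (MF i); have MEDF := MD _ _ ME (MF i).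
have [|l [lE lS]] := IH _ MEDF.
  move=> x [Ex NFx]; have [j] := EF x Ex.
  by rewrite inE => /predU1P[->//|js Fjx]; exists j.
exists ((m (E `&` F i), i) :: l); split=> [|y]; rewrite big_cons /=.
  by rewrite lE -mD.
rewrite (mD (E `&` S y) (F i)) //; last exact: MI.
rewrite lerD //; last by apply: le_trans (lS y); rewrite !setDE setIAC.
(* For [y] outside [A i], [FSA] makes [F i] and [S y] disjoint, so the new piece contributes
   nothing. *)
rewrite indicE; have [Aiy|NAiy] := pselect (A i y).
  rewrite mem_set // mulr1; apply: content_le => //; last by move=> x [[]].
  exact: MI (MI _ _ ME (MS y)) (MF i).
rewrite memNset // mulr0 (_ : _ `&` F i = set0) ?content_set0//.
by rewrite -subset0 => x [[_ Sx] Fx]; case: NAiy; exact: FSA Fx Sx.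
Qed.

End finite_content.

(** The [B i] are added one at a time: only the part of [B i] outside the union [V] of the others
    has to be halved, and [t i] preserves that part because it preserves every [B j]. *)
Lemma content_half {R : realType} {T : Type} (M : set (set T)) (m : set T -> R)
    (I : eqType) (E : set T) (B : I -> set T) (t : I -> T -> T) (s : seq I) :
  finite_content M m -> M E -> (forall i, M (B i)) ->
  (forall i A, M A -> M (t i @` A)) ->
  (forall i A, M A -> m (t i @` A) = m A) ->
  (forall i j x, B j (t i x) <-> B j x) ->
  (forall i x, E x -> B i x -> ~ E (t i x)) ->
  let U := [set x | exists2 i, i \in s & B i x] in
  M U /\ m (E `&` U) *+ 2 <= m U.
Proof.
move=> mM ME MB Mt mt Bt Et; have [MT MI MD m0 mD] := mM.
elim: s => [|i s [MU IH]] U.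
  have -> : U = set0 by rewrite -subset0 => x [].
  rewrite setI0 (content_set0 mM) mul0rn; split=> //.
  by rewrite -(setDv setT); exact: MD.
set V := [set x | exists2 i, i \in s & B i x] in MU IH.
have UV : U = B i `|` V.
  apply/seteqP; split=> x /=.
    by move=> [j]; rewrite inE => /predU1P[->|js]; [left|right; exists j].
  move=> [Bx|[j js Bj]]; first by exists i; rewrite ?mem_head.
  by exists j; rewrite ?inE ?js ?orbT.
have MU' : M U.
  rewrite UV -(setCK (_ `|` _)) setCU -setTD; apply: (MD) => //.
  by apply: (MI); rewrite -setTD; exact: MD.
split=> //.
have UDV : U `\` V = B i `\` V by rewrite UV setDUl setDv setU0.
have UIV : U `&` V = V by rewrite UV; apply: setIidr; right.
rewrite (mD U V) // (mD (E `&` U) V) //; last exact: MI.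
rewrite -setIA UIV -setIDA UDV mulrnDl lerD //.
set D := B i `\` V; have MDD : M D by exact: MD.
have MA : M (E `&` D) by exact: MI.
have DE : D `&` (E `&` D) = E `&` D by apply: setIidr => x [].
rewrite mulr2n (mD D (E `&` D)) // DE lerD // -{1}(mt i) //.
apply: (content_le mM); [exact: Mt|exact: MD|].
move=> _ [x [Ex [Bx Vx]] <-]; split; last first.
  by move=> [Etx _]; exact: Et Etx.
split; first exact/Bt.
by move=> [j js /Bt Bj]; apply: Vx; exists j.
Qed.

(** * Groups *)

Lemma group_mulK (T : Type) (mul : T -> T -> T) inv one :
  group_laws mul inv one -> forall x y, mul (inv x) (mul x y) = y.
Proof. by move=> [mA m1 _ mV _] x y; rewrite mA mV. Qed.

Lemma group_mulKV (T : Type) (mul : T -> T -> T) inv one :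
  group_laws mul inv one -> forall x y, mul x (mul (inv x) y) = y.
Proof. by move=> [mA m1 _ _ mV] x y; rewrite mA mV. Qed.

Lemma group_invK (T : Type) (mul : T -> T -> T) inv one :
  group_laws mul inv one -> involutive inv.
Proof.
move=> gT x; case: (gT) => _ _ m1 mV _.
by rewrite -[LHS]m1 -(mV x) (group_mulK gT).
Qed.

Lemma group_invM (T : Type) (mul : T -> T -> T) inv one :
  group_laws mul inv one -> forall x y, inv (mul x y) = mul (inv y) (inv x).
Proof.
move=> gT x y; case: (gT) => mA _ m1 _ mV.
by rewrite -(group_mulK gT (mul x y) (mul (inv y) (inv x))) -mA
  (group_mulKV gT) mV m1.
Qed.

Lemma image_mul (T : Type) (mul : T -> T -> T) inv one :
  group_laws mul inv one -> forall s (A : set T),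
  [set mul s a | a in A] = [set x | A (mul (inv s) x)].
Proof.
move=> gT s A; apply/seteqP; split=> [_ [a Aa <-]|x Ax] /=.
  by rewrite (group_mulK gT).
by exists (mul (inv s) x) => //; rewrite (group_mulKV gT).
Qed.

Lemma group_mulrK (T : Type) (mul : T -> T -> T) inv one :
  group_laws mul inv one -> forall x y, mul (mul y x) (inv x) = y.
Proof. by move=> [mA _ m1 _ mV] x y; rewrite -mA mV. Qed.

Lemma subgroup_closed (T : Type) (mul : T -> T -> T) inv one (H : set T) :
  group_laws mul inv one -> H one ->
  (forall x y, H x -> H y -> H (mul x (inv y))) ->
  (forall x, H x -> H (inv x)) /\ (forall x y, H x -> H y -> H (mul x y)).
Proof.
move=> gT H1 HD; have [_ m1 _ _ _] := gT.
have HV x : H x -> H (inv x) by move=> Hx; rewrite -[inv x]m1; exact: HD.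
split=> // x y Hx Hy; rewrite -[y](group_invK gT).
by apply: HD => //; exact: HV.
Qed.

Lemma group_morphV (T T' : Type) (mul : T -> T -> T) inv one
    (mul' : T' -> T' -> T') inv' one' (H : set T) (f : T -> T') :
  group_laws mul inv one -> group_laws mul' inv' one' ->
  H one -> (forall x, H x -> H (inv x)) ->
  (forall x y, H x -> H y -> f (mul x y) = mul' (f x) (f y)) ->
  f one = one' /\ (forall x, H x -> f (inv x) = inv' (f x)).
Proof.
move=> gT gT' H1 HV fM; have [_ m1 _ mV mVr] := gT; have [_ _ m1' mV' _] := gT'.
have f1 : f one = one'.
  by rewrite -(group_mulK gT' (f one) (f one)) -fM // m1 mV'.
split=> // x Hx.
by rewrite -(group_mulK gT' (f x) (f (inv x))) -fM ?mVr ?f1 ?m1' //; exact: HV.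
Qed.

(** * Compact spaces and products *)

Lemma compact_finite_cover (T : topologicalType) (I : eqType) (K : set T)
    (B : I -> set T) : compact K -> (forall i, open (B i)) ->
  K `<=` \bigcup_i B i ->
  exists s : seq I, forall x, K x -> exists2 i, i \in s & B i x.
Proof.
move=> /compact_near_coveringP cK oB KB.
(* Sets in [F] contain all lists that include some given list; near covering along [F] merges the
   local indices into one list. *)
pose F := filter_from [set: seq I] (fun s => [set t : seq I | {subset s <= t}]).
have FF : Filter F.
  apply: filter_from_filter; first by exists [::].
  move=> s t _ _; exists (s ++ t) => // u stu.
  by split=> i ist; apply: stu; rewrite mem_cat ist ?orbT.
have [|s _ sK] := cK _ F (fun s x => exists2 i, i \in s & B i x) FF.
  move=> x /KB[i _ Bix]; exists (B i, [set t : seq I | i \in t]) => /=.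
    split; first by apply: open_nbhs_nbhs.
    by exists [:: i] => // t; apply; rewrite mem_head.
  by move=> [y t] [/= Biy it]; exists i.
by exists s => x Kx; apply: sK.
Qed.

Lemma ptws_continuous (I : Type) (S T : topologicalType)
    (f : S -> {ptws I -> T}) :
  (forall i, continuous (fun x => f x i)) -> continuous f.
Proof.
move=> fc x; apply/cvg_sup => i.
exact: (@continuous_comp_initial _ S T (@proj I (fun=> T) i) f (fc i) x).
Qed.

Lemma ptws_proj_continuous (I : eqType) (T : topologicalType) (i : I) :
  continuous (fun x : {ptws I -> T} => x i).
Proof. exact: proj_continuous. Qed.

Lemma group_mul_continuous (S T : topologicalType) (mul : T -> T -> T) inv one
    (f g : S -> T) : topological_group mul inv one ->
  continuous f -> continuous g -> continuous (fun x => mul (f x) (g x)).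
Proof.
move=> [_ [mc _]] fc gc x; apply: continuous2_cvg; [|exact: fc|exact: gc].
exact: (mc (f x, g x)).
Qed.

Lemma group_inv_continuous (S T : topologicalType) (mul : T -> T -> T) inv one
    (f : S -> T) : topological_group mul inv one ->
  continuous f -> continuous (fun x => inv (f x)).
Proof.
move=> [_ [_ ic]] fc x; apply: (@continuous_comp _ _ _ f inv); first exact: fc.
exact: ic.
Qed.

Lemma compact_group_ptws (T : topologicalType) (mul : T -> T -> T) inv one k :
  compact_group mul inv one ->
  @compact_group {ptws 'I_k -> T} (@tmul T mul k) (fun x i => inv (x i))
    (fun=> one).
Proof.
move=> [tg cT hT]; have [[mA m1 m1r mV mVr] _] := tg; split; first split.
- by split=> *; apply/funext => i; rewrite /tmul.
- split; apply: ptws_continuous => i.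
    apply: (group_mul_continuous tg) => x.
      apply: (@continuous_comp _ _ _ fst (fun x : {ptws 'I_k -> T} => x i)).
        exact: cvg_fst.
      exact: ptws_proj_continuous.
    apply: (@continuous_comp _ _ _ snd (fun x : {ptws 'I_k -> T} => x i)).
      exact: cvg_snd.
    exact: ptws_proj_continuous.
  by apply: (group_inv_continuous tg); exact: ptws_proj_continuous.
- have := @tychonoff _ (fun _ : 'I_k => T) (fun=> setT) (fun=> cT).
  by rewrite (_ : [set f | _] = setT) //; apply/seteqP; split.
- exact: (@hausdorff_product _ (fun _ : 'I_k => T) (fun=> hT)).
Qed.

(** Meant for [f := pi], continuous only within [H], with [r] selecting the first [n+1]
    coordinates. *)
Lemma ptws_within_continuous (I J : eqType) (T T' : topologicalType) (H : set T)
    (S : set {ptws I -> T}) (f : T -> T') (r : J -> I) :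
  {within H, continuous f} -> (forall x j, S x -> H (x (r j))) ->
  {within S, continuous (fun x => (fun j => f (x (r j))) : {ptws J -> T'})}.
Proof.
move=> /subspace_continuousP fc SH; apply: ptws_continuous => j.
apply/subspace_continuousP => x Sx A nA.
have := @ptws_proj_continuous I T (r j) x _ (fc _ (SH x j Sx) A nA).
rewrite nbhs_simpl /= => nH; apply: (filterS _ nH) => y /= HA Sy.
by apply: HA; exact: SH.
Qed.

(** * Borel sets and Haar measures *)

Section borel.
Context {T : topologicalType}.
Implicit Types A B : set T.

Lemma borel_open A : open A -> borel A.
Proof. exact: sub_sigma_algebra. Qed.

Let borelP : [/\ @borel T setT, setSD_closed (@borel T), ndseq_closed (@borel T)
  & setI_closed (@borel T)].
Proof. by apply/sigma_algebraP => //; exact: smallest_sigma_algebra. Qed.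

Lemma borelT : borel [set: T]. Proof. by case: borelP. Qed.

Lemma borelI A B : borel A -> borel B -> borel (A `&` B).
Proof. by case: borelP => _ _ _; apply. Qed.

Lemma borelC A : borel A -> borel (~` A).
Proof. by move=> bA; rewrite -setTD; exact: sigma_algebraCD. Qed.

Lemma borelD A B : borel A -> borel B -> borel (A `\` B).
Proof. by move=> bA bB; rewrite setDE; apply: borelI => //; exact: borelC. Qed.

Lemma borel_closed A : closed A -> borel A.
Proof.
move=> cA; rewrite -(setCK A); apply: borelC; apply: borel_open.
by rewrite openC.
Qed.

End borel.

Lemma borel_preimage (S T : topologicalType) (f : S -> T) (A : set T) :
  continuous f -> borel A -> borel (f @^-1` A).
Proof.
move=> fc; apply: (@smallest_sub _ _ _ [set B | borel (f @^-1` B)]).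
  have := sigma_algebra_image f (smallest_sigma_algebra setT (@open S)).
  by rewrite /image_set_system; under eq_fun do rewrite setTI.
by move=> U oU; apply: borel_open; apply: open_comp => // x _; exact: fc.
Qed.

Section haar_content.
Context {R : realType} {T : topologicalType} (mul : T -> T -> T) (S : set T).
Variable mu : set T -> \bar R.
Hypothesis muP : haar_measure mul S mu.

Lemma haar_split A B : borel A -> borel B ->
  (mu A = mu (A `&` B) + mu (A `\` B))%E.
Proof.
move=> bA bB; case: muP => mu0 [_ mus] _ _ _.
have b1 := borelI bA bB; have b2 := borelD bA bB.
(* The sequence continues with empty sets, so its partial sums are constant from index 2 on. *)
have cvgA := mus (bigcup2 (A `&` B) (A `\` B)) _ _.
rewrite bigcup2E setUIDK in cvgA.
apply: (cvg_unique _ (cvgA _ _)) => //.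
- by move=> [|[|i]]//=; exact: sigma_algebra0.
- by rewrite -trivIset_bigcup2 -subset0 => x [[_ Bx] [_]].
apply: cvg_near_cst; exists 2%N => // k /= k2.
by rewrite -(subnKC k2) big_nat_recl // big_nat_recl //= big1 ?adde0.
Qed.

Lemma haar_fin A : borel A -> (mu A = (fine (mu A))%:E)%E.
Proof.
move=> bA; rewrite fineK //; have := haar_split borelT bA.
case: muP => _ [mu0 _] [-> _] _ _; rewrite setTI => e.
by rewrite ge0_fin_numE ?mu0 // (@le_lt_trans _ _ 1%E) ?ltry // e leeDl //
  mu0 // setTD; exact: borelC.
Qed.

Lemma haar_content : finite_content (@borel T) (fine \o mu).
Proof.
split; [exact: borelT|exact: borelI|exact: borelD| |].
  by move=> A bA; rewrite fine_ge0 //; case: muP => _ [+ _] _ _ _; exact.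
move=> A B bA bB /=; rewrite (haar_split bA bB) fineD // haar_fin //.
  exact: borelI.
exact: borelD.
Qed.

Lemma haar_outer A e : borel A -> 0 < e -> exists U, [/\ open U, A `<=` U &
  fine (mu U) <= fine (mu A) + e].
Proof.
move=> bA e0; case: (muP) => _ _ _ _ [/(_ _ bA) muA _].
have [|_ [U [oU AU] <-]] := @lb_ereal_inf_adherent R
  [set mu U | U in [set U | open U /\ A `<=` U]] e e0.
  by rewrite -muA haar_fin.
rewrite -muA (haar_fin bA) (haar_fin (borel_open oU)) -EFinD lte_fin => /ltW.
by exists U.
Qed.

(** The bound stays in the extended reals: without a Hausdorff hypothesis [C] is not known to be
    Borel, hence [mu C] not known to be finite. *)
Lemma haar_inner U e : open U -> 0 < e -> exists C, [/\ compact C, C `<=` U &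
  ((fine (mu U) - e)%:E < mu C)%E].
Proof.
move=> oU e0; case: (muP) => _ _ _ _ [_ /(_ _ oU) muU].
have bU := borel_open oU.
have [|_ [C [cC CU] <-]] := @ub_ereal_sup_adherent R
  [set mu C | C in [set C | compact C /\ C `<=` U]] e e0.
  by rewrite -muU haar_fin.
by rewrite -muU (haar_fin bU) -EFinB => h; exists C.
Qed.

End haar_content.

(** * Comparison of invariant contents with Haar measure *)

(* The image of [m] under [phi : S -> Y] is an invariant probability. *)
Definition invariant_content {R : realType} {X : Type} {Y : topologicalType}
    (mul : Y -> Y -> Y) (inv : Y -> Y) (M : set (set X)) (m : set X -> R)
    (S : set X) (phi : X -> Y) : Prop :=
  [/\ finite_content M m, M S, m S = 1,
      forall U, open U -> M (S `&` phi @^-1` U) &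
      forall y C, closed C ->
        m (S `&` phi @^-1` [set z | C (mul (inv y) z)]) =
        m (S `&` phi @^-1` C)].

(* Double counting of the pairs [(x, y)] with [(phi x)^-1 y \in C]. *)
Lemma haar_compare_inv {R : realType} {X : Type} {Y : topologicalType}
    (mul : Y -> Y -> Y) (inv : Y -> Y) (one : Y) (M : set (set X))
    (m : set X -> R) (S : set X) (phi : X -> Y) (mu : set Y -> \bar R) C :
  compact_group mul inv one -> invariant_content mul inv M m S phi ->
  haar_measure mul setT mu -> closed C ->
  m (S `&` phi @^-1` (inv @^-1` C)) <= fine (mu C).
Proof.
move=> cY [mM MS mS Mphi m_inv] muP cC; have [tg cT _] := cY; have [gY _] := tg.
have [mA m1 m1r mV mVr] := gY.
have ilc y : continuous (fun z => mul (inv y) z).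
  by apply: (group_mul_continuous tg) => z; [exact: cvg_cst|exact: cvg_id].
have ic : continuous inv by case: tg => _ [].
have McC D : closed D -> M (S `&` phi @^-1` D).
  move=> cD; case: mM => _ _ MD _ _.
  have -> : S `&` phi @^-1` D = S `\` (S `&` phi @^-1` (~` D)).
    by rewrite setDIr setDv set0U preimage_setC setDE setCK.
  by apply: MD => //; apply: Mphi; rewrite openC.
apply/ler_addgt0Pr => e e0.
have [W [oW CW muW]] := haar_outer muP (borel_closed cC) e0.
apply: le_trans muW.
have kC : compact C := subclosed_compact cC cT (@subsetT _ _).
(* Tube lemma: continuity of [mul] at each [(one, c)] is made uniform over the compact set [C]. *)
have [V [oV V1 VC]] : exists V, [/\ open V, V one &
    forall v c, V v -> C c -> W (mul v c)].
  have nV : \forall v \near one, C `<=` [set c | W (mul v c)].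
    move/compact_near_coveringP: kC; apply => c Cc; have [_ [mc _]] := tg.
    have : nbhs (one, c) [set p | W (mul p.1 p.2)].
      by apply: mc; rewrite /= m1; apply: open_nbhs_nbhs; split=> //; exact: CW.
    move=> [[P Q] /= [nP nQ] PQ]; exists (Q, P) => //= -[a b] [Qa Pb].
    exact: (PQ (b, a)).
  exists (interior [set v | C `<=` [set c | W (mul v c)]]).
  split=> [|//|v c /interior_subset]; [exact: open_interior|exact].
have olV y : open [set z | V (mul (inv y) z)].
  by apply: (open_comp _ oV) => z _; exact: ilc.
have olW y : open [set z | W (mul (inv y) z)].
  by apply: (open_comp _ oW) => z _; exact: ilc.
have [|s Vs] := compact_finite_cover cT olV.
  by move=> y _; exists y => //=; rewrite mV.
have cCV y : closed [set z | C (mul (inv z) y)].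
  apply: (closed_comp _ cC) => z _.
  apply: (group_mul_continuous tg) => {}z; [exact: ic|exact: cvg_cst].
(* If [g^-1 (phi x)] is in [V] and [(phi x)^-1 y] is in [C], their product [g^-1 y] is in [W]. *)
have [|y|||x Sx|l [l1 lC]] := @content_cover_weights _ _ _ _ mM Y Y
  (fun g => S `&` phi @^-1` [set z | V (mul (inv g) z)])
  (fun g => [set y | W (mul (inv g) y)])
  (fun y => S `&` phi @^-1` [set z | C (mul (inv z) y)]) s S.
- by move=> g; exact: Mphi.
- exact: McC.
- by [].
- move=> g x y [_ /= Vx] [_ /= Cx].
  by have := VC _ _ Vx Cx; rewrite -mA (group_mulKV gY).
- by have [g gs Vg] := Vs (phi x) I; exists g.
have := @content_simple_ge _ _ _ _ (haar_content muP) _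
  (fun g => [set y | W (mul (inv g) y)]) l
  (m (S `&` phi @^-1` (inv @^-1` C))) setT.
rewrite /= (_ : fine (mu setT) = 1); last by case: muP => _ _ [-> _].
rewrite mulr1 => cW; apply: le_trans (cW _ borelT _) _ => {cW}.
- by move=> g; exact: borel_open.
(* [(phi x)^-1 y] is in [C] iff [y^-1 (phi x)] is in [C^-1], so by invariance the content does not
   depend on [y]. *)
- move=> y _; apply: le_trans (lC y).
  have <- := m_inv y (inv @^-1` C).
    rewrite setIA setIid (_ : [set z | _] = [set z | C (mul (inv z) y)]) //.
    by apply/seteqP; split=> z /=; rewrite (group_invM gY) (group_invK gY).
  by apply: (closed_comp _ cC) => z _; exact: ic.
(* All translates of [W] have measure [mu W], and the weights sum to [m S = 1]. *)
rewrite (eq_bigr (fun p => p.1 * fine (mu W))) => [|p _].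
  by rewrite -mulr_suml l1 mS mul1r.
rewrite setIT; case: muP => _ _ _ + _ => /(_ p.2 W Logic.I (borel_open oW)).
by rewrite (image_mul gY) => ->.
Qed.

(** The previous bound, for [m] at [C^-1] and then for [mu] itself at [C], passes through
    [mu (C^-1)]. *)
Lemma haar_compare {R : realType} {X : Type} {Y : topologicalType}
    (mul : Y -> Y -> Y) (inv : Y -> Y) (one : Y) (M : set (set X))
    (m : set X -> R) (S : set X) (phi : X -> Y) (mu : set Y -> \bar R) C :
  compact_group mul inv one -> invariant_content mul inv M m S phi ->
  haar_measure mul setT mu -> closed C ->
  m (S `&` phi @^-1` C) <= fine (mu C).
Proof.
move=> cY mP muP cC; have [[gY [_ ic]] _ _] := cY.
have cV : closed (inv @^-1` C) by apply: (closed_comp _ cC) => z _; exact: ic.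
have := haar_compare_inv cY mP muP cV.
rewrite (_ : inv @^-1` (inv @^-1` C) = C); last first.
  by apply/seteqP; split=> z; rewrite /= (group_invK gY).
move=> /le_trans; apply.
have muI : invariant_content mul inv (@borel Y) (fine \o mu) setT id.
  split; [exact: haar_content muP|exact: borelT| | |].
  - by case: muP => _ _ [/= -> _].
  - by move=> U oU; rewrite setTI; exact: borel_open.
  - move=> y D cD; rewrite /= !setTI !preimage_id.
    case: muP => _ _ _ + _ => /(_ y D Logic.I (borel_closed cD)).
    by rewrite (image_mul gY) => ->.
by have := haar_compare_inv cY muI muP cC; rewrite preimage_id setTI.
Qed.

(** * Commutators *)

Section commutators.
Context {T : Type} (mul : T -> T -> T) (inv : T -> T) (one : T).

Lemma tcommSr k (x : 'I_k.+2 -> T) :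
  tcomm mul inv one x = comm mul inv
    (tcomm mul inv one (fun i => x (widen_ord (leqnSn k.+1) i))) (x ord_max).
Proof.
rewrite /tcomm enum_ordSr map_rcons -map_comp enum_ordSl /=.
by rewrite foldl_rcons.
Qed.

Lemma comm_eq1 : group_laws mul inv one ->
  forall x y, comm mul inv x y = one <-> mul x y = mul y x.
Proof.
move=> gT x y; have [mA m1 m1r mV mVr] := gT.
rewrite /comm -(group_invM gT); split=> [e|->]; last by rewrite mV.
by rewrite -[RHS]m1r -e (group_mulKV gT).
Qed.

(** [f] is multiplicative only on [H], so membership in [H] is carried through the induction. *)
Lemma lcomm_morph (T' : Type) (mul' : T' -> T' -> T') (inv' : T' -> T')
    (one' : T') (H : set T) (f : T -> T') (I : Type) (x : I -> T) (s : seq I) :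
  H one -> (forall x y, H x -> H y -> H (mul x y)) ->
  (forall x, H x -> H (inv x)) ->
  f one = one' -> (forall x y, H x -> H y -> f (mul x y) = mul' (f x) (f y)) ->
  (forall x, H x -> f (inv x) = inv' (f x)) ->
  (forall i, H (x i)) ->
  H (lcomm mul inv one (map x s)) /\
  f (lcomm mul inv one (map x s)) =
  lcomm mul' inv' one' (map (fun i => f (x i)) s).
Proof.
move=> H1 HM HV f1 fM fV Hx; case: s => [//|i s] /=.
elim: s (x i) (Hx i) => [//|j s IH] z Hz /=.
have [HVz HVj] := (HV _ Hz, HV _ (Hx j)).
have -> : comm mul' inv' (f z) (f (x j)) = f (comm mul inv z (x j)).
  by rewrite /comm !fM ?fV //; exact: HM.
by apply: IH; apply: (HM); exact: HM.
Qed.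

End commutators.

Lemma lcomm_continuous (S T : topologicalType) (mul : T -> T -> T) inv one
    (I : Type) (f : S -> I -> T) (s : seq I) :
  topological_group mul inv one -> (forall i, continuous (f^~ i)) ->
  continuous (fun x => lcomm mul inv one (map (f x) s)).
Proof.
move=> tg fc; case: s => [|i s] /=; first by move=> x; exact: cvg_cst.
suff : forall g : S -> T, continuous g ->
    continuous (fun x => foldl (comm mul inv) (g x) (map (f x) s)).
  by move=> /(_ _ (fc i)).
elim: s => [//|j s IH] g gc /=.
apply: (IH (fun x => comm mul inv (g x) (f x j))).
apply: (group_mul_continuous tg); last exact: group_mul_continuous tg gc (fc j).
apply: (group_mul_continuous tg).
  exact: group_inv_continuous tg gc.
exact: group_inv_continuous tg (fc j).
Qed.

Lemma tcomm_continuous (T : topologicalType) (mul : T -> T -> T) inv one k :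
  topological_group mul inv one ->
  continuous (fun x : {ptws 'I_k -> T} => tcomm mul inv one x).
Proof.
move=> tg; apply: (@lcomm_continuous {ptws 'I_k -> T} T mul inv one _
  (fun x i => x i)) => // i.
exact: ptws_proj_continuous.
Qed.

Lemma closed_tcomm_eq1 (T : topologicalType) (mul : T -> T -> T) inv one k :
  compact_group mul inv one ->
  closed [set x : {ptws 'I_k -> T} | tcomm mul inv one x = one].
Proof.
move=> [tg _ hT]; have c1 : closed [set one].
  by apply: accessible_closed_set1; exact: hausdorff_accessible.
exact: ((continuous_closedP _).1 (tcomm_continuous (k := k) tg) _ c1).
Qed.

(** * Trivial commutators against central ones: the factor 1/2 *)

Section commutator_measure.
Context {R : realType} {G : topologicalType}.
Variables (mul : G -> G -> G) (inv : G -> G) (one : G) (n : nat).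
Local Notation X := {ptws 'I_n.+2 -> G}.
Local Notation c := (fun x : X =>
  tcomm mul inv one (fun i => x (widen_ord (leqnSn n.+1) i))).
Variables (S : set X) (mu : set X -> \bar R).
Hypothesis cG : compact_group mul inv one.
Hypothesis muP : @haar_measure R X (@tmul G mul n.+2) S mu.
Hypothesis S_last : forall g, S (fun i => if i == ord_max then g else one).

(** Invariance of [mu] is available only under [S]; by [S_last] this covers the translations by
    [(1, .., 1, g)] for every [g] in [G]. *)
Lemma haar_comm_half :
  borel [set x : X | group_center mul (c x)] /\
  fine (mu [set x : X | tcomm mul inv one x = one]) <=
    2^-1 * (1 + fine (mu [set x : X | group_center mul (c x)])).
Proof.
have [tg _ hG] := cG; have [gG _] := tg.
have [mA m1 _ _ _] := gG.
have [tgX cX hX] := compact_group_ptws n.+2 cG; have [gX _] := tgX.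
have cc : continuous c.
  apply: (@lcomm_continuous X G mul inv one _
    (fun x i => x (widen_ord (leqnSn n.+1) i))) => // i.
  exact: ptws_proj_continuous.
have c1 : closed [set one].
  by apply: accessible_closed_set1; exact: hausdorff_accessible.
set E := [set x : X | tcomm mul inv one x = one].
have cE : closed E by exact: closed_tcomm_eq1.
pose B g := [set x : X | comm mul inv (c x) g <> one].
have oB g : open (B g).
  apply: ((continuousP (fun x => comm mul inv (c x) g)).1 _ (~` [set one])).
    (* The commutator of [c x] and [g] is written as [lcomm] over a list of two booleans. *)
    apply: (@lcomm_continuous X G mul inv one _
      (fun x (b : bool) => if b then c x else g) [:: true; false]) => // -[].
      exact: cc.
    exact: cst_continuous.
  by rewrite openC.
pose t g : X -> X := tmul mul (fun i => if i == ord_max then g else one).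
have ct g x : c (t g x) = c x.
  congr (@tcomm _ mul inv one _); apply/funext => i.
  by rewrite /t /tmul -val_eqE /= ltn_eqF // m1.
pose U := \bigcup_g B g.
have oU : open U by apply: bigcup_open => g _.
have AU : [set x : X | group_center mul (c x)] = ~` U.
  apply/seteqP; split=> x /= => [zx [g _]|Nx g].
    by apply; apply/(comm_eq1 gG); exact: zx.
  apply/(comm_eq1 gG); apply: contrapT => Ng; apply: Nx.
  by exists g.
have mm := haar_content muP; have [_ _ _ m0 mD] := mm.
have bU := borel_open oU; have bE := borel_closed cE.
have half : fine (mu (E `&` U)) *+ 2 <= fine (mu U).
  apply/ler_addgt0Pr => e e0; have e20 : 0 < e / 2 by rewrite divr_gt0.
  have [K [kK KU muK]] := haar_inner muP oU e20.
  have bK : borel K by apply: borel_closed; exact: compact_closed.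
  move: muK; rewrite (haar_fin muP bK) lte_fin => muK.
  have [s Ks] := compact_finite_cover kK oB KU.
  have [|g A bA|g A bA|g h x|g x|] := @content_half R X (@borel X)
    (fine \o mu) G E B t s mm bE.
  - by move=> g; exact: borel_open.
  - rewrite (image_mul gX); set u : X := (X in tmul mul X).
    apply: (@borel_preimage X X (fun x => tmul mul u x)) bA.
    exact: (group_mul_continuous tgX (@cst_continuous _ _ u) (fun=> cvg_id)).
  - by case: muP => _ _ _ /= + _ => ->.
  - by rewrite /B /= ct.
  (* The last coordinate of [t g x] is [g] times that of [x]; if [c x] commutes with both, it
     commutes with [g]. *)
  - rewrite /E /B /= !tcommSr ct /t /tmul eqxx => /(comm_eq1 gG) cx cg.
    move=> /(comm_eq1 gG) ctx; apply: cg; apply/(comm_eq1 gG).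
    rewrite -[LHS](group_mulrK gG (x ord_max)) -(mA _ g (x ord_max)) ctx.
    by rewrite -(mA g) -cx (mA g) (group_mulrK gG).
  set V := [set x | _] => /= bV hV.
  have KV : K `<=` V by [].
  have VU : V `<=` U by move=> x [g _ Bg]; exists g.
  have := content_le mm bK bV KV.
  (* The halving holds on [V], and [V] misses less than [e / 2] of [U]. *)
  have := mD U V bU bV; rewrite (setIidr VU) /=.
  have := mD (E `&` U) V (borelI bE bU) bV; rewrite -setIA (setIidr VU) /=.
  have : fine (mu ((E `&` U) `\` V)) <= fine (mu (U `\` V)).
    apply: (content_le mm); try (by do ?apply: borelD => //; apply: borelI).
    by move=> x [[]].
  lra.
rewrite AU; split; first exact: borelC.
(* With [mu U = 1 - mu A], the sum [mu U / 2 + mu A] equals [(1 + mu A) / 2]. *)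
have : fine (mu (E `\` U)) <= fine (mu (~` U)).
  by apply: (content_le mm); [exact: borelD|exact: borelC|move=> x []].
have := mD E U bE bU => /=.
have -> : fine (mu (~` U)) = 1 - fine (mu U).
  by rewrite -/((fine \o mu) _) (content_setC mm) //=; case: muP => _ _ [-> _].
lra.
Qed.

End commutator_measure.

(** * Pushing the measure forward to the quotient *)

Section quotient.
Context {R : realType} {G Q : topologicalType}.
Variables (mul : G -> G -> G) (inv : G -> G) (one : G) (H : set G).
Variables (mulQ : Q -> Q -> Q) (invQ : Q -> Q) (oneQ : Q) (pi : G -> Q).
Variable n : nat.
Local Notation X := {ptws 'I_n.+2 -> G}.
Local Notation Y := {ptws 'I_n.+1 -> Q}.
Variables (mu : set X -> \bar R) (muQ : set Y -> \bar R).
Local Notation S := [set x : X | forall i : 'I_(n.+2), (i < n.+1)%N -> H (x i)].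
Local Notation phi :=
  (fun x : X => (fun i => pi (x (widen_ord (leqnSn n.+1) i))) : Y).
Hypothesis cG : compact_group mul inv one.
Hypothesis sH : closed_subgroup mul inv one H.
Hypothesis cQ : compact_group mulQ invQ oneQ.
Hypothesis piM :
  forall x y, H x -> H y -> pi (mul x y) = mulQ (pi x) (pi y).
Hypothesis pi_cont : {within H, continuous pi}.
Hypothesis pi_surj : forall q, exists2 h, H h & pi h = q.
Hypothesis muP : @haar_measure R X (@tmul G mul n.+2) S mu.
Hypothesis muQP : @haar_measure R Y (@tmul Q mulQ n.+1) setT muQ.

Lemma borel_ptws_subgroup : borel S.
Proof.
have [clH _ _] := sH.
rewrite (_ : S = \bigcap_(i in [set i : 'I_n.+2 | (i < n.+1)%N])
    (fun x : X => x i) @^-1` H); last first.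
  by apply/seteqP; split=> x Sx i; exact: Sx.
apply: borel_closed; apply: closed_bigI => i _.
exact: ((continuous_closedP _).1 (@ptws_proj_continuous _ G i) _ clH).
Qed.

(** [phi] is continuous only within [S], so the preimage is the trace on [S] of an open set. *)
Lemma borel_quotient_open U : open U -> borel (S `&` phi @^-1` U).
Proof.
have phic : {within S, continuous phi}.
  apply: (ptws_within_continuous (r := widen_ord (leqnSn n.+1)) pi_cont).
  by move=> x j; apply; exact: (ltn_ord j).
move=> oU; have /continuousP/(_ U oU)/open_subspaceP[V oV VS] := phic.
rewrite setIC -VS; apply: borelI; first exact: borel_open.
exact: borel_ptws_subgroup.
Qed.

Lemma borel_quotient_closed C : closed C -> borel (S `&` phi @^-1` C).
Proof.
move=> clC; have -> : S `&` phi @^-1` C = S `\` (S `&` phi @^-1` (~` C)).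
  by rewrite setDIr setDv set0U preimage_setC setDE setCK.
apply: borelD; first exact: borel_ptws_subgroup.
by apply: borel_quotient_open; rewrite openC.
Qed.

(** Translation by [y] lifts to translation by a tuple [s] of [S] with [phi s = y]. *)
Lemma haar_quotient_invariant (y : Y) (C : set Y) : closed C ->
  fine (mu (S `&` phi @^-1` [set z | C (tmul mulQ (fun i => invQ (y i)) z)]))
  = fine (mu (S `&` phi @^-1` C)).
Proof.
have [[gG _] _ _] := cG; have [[gQ _] _ _] := cQ; have [_ H1 HD] := sH.
have [HV HM] := subgroup_closed gG H1 HD.
have [pi1 piV] := group_morphV gG gQ H1 HV piM.
have [[gGn _] _ _] := compact_group_ptws n.+2 cG.
move=> clC; have [h hH hpi] : exists2 h : Q -> G, (forall q, H (h q)) &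
    forall q, pi (h q) = q.
  by exists (fun q => s2val (cid2 (pi_surj q))) => q; case: cid2.
(* At the last index [inord] falls back to 0; this is harmless, since [S] leaves that coordinate
   free and [phi] forgets it. *)
pose s : X := fun i => h (y (inord i)).
have Ss : S s by move=> i _; exact: hH.
have ps : phi s = y.
  by apply/funext => i; rewrite /s /= inord_val hpi.
case: (muP) => _ _ _ + _ => /(_ s _ Ss (borel_quotient_closed clC)).
rewrite (image_mul gGn) => <-; congr (fine (mu _)).
have Sinv x : S (tmul mul (fun i => inv (s i)) x) <-> S x.
  split=> Sx i lti; have := Sx i lti; have Hs := Ss i lti; rewrite /tmul.
    by move=> Hsx; rewrite -(group_mulKV gG (s i) (x i)); exact: HM.
  by move=> Hx; apply: HM => //; exact: HV.
have phiM x : S x -> phi (tmul mul (fun i => inv (s i)) x) =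
    tmul mulQ (fun i => invQ (y i)) (phi x).
  move=> Sx; apply/funext => i; rewrite /tmul -ps.
  have [Hs Hx] : H (s (widen_ord (leqnSn n.+1) i)) /\
      H (x (widen_ord (leqnSn n.+1) i)).
    by split; [apply: Ss|apply: Sx]; exact: (ltn_ord i).
  by rewrite piM ?piV //; exact: HV.
apply/seteqP; split=> x [Sx Cx].
  split; first exact/Sinv.
  by rewrite /preimage /mkset phiM.
have {}Sx := (Sinv x).1 Sx; split=> //.
by move: Cx; rewrite /preimage /mkset phiM.
Qed.

Lemma haar_quotient_le C : closed C ->
  fine (mu (S `&` phi @^-1` C)) <= fine (muQ C).
Proof.
have muI : @invariant_content R X Y (@tmul Q mulQ n.+1)
    (fun x i => invQ (x i)) (@borel X) (fine \o mu) S phi.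
  split; [exact: haar_content muP|exact: borel_ptws_subgroup| | |].
  - by case: muP => _ _ [_ /= ->].
  - exact: borel_quotient_open.
  - exact: haar_quotient_invariant.
exact: haar_compare (compact_group_ptws n.+1 cQ) muI muQP.
Qed.

Lemma tcomm_quotient (x : X) : S x ->
  let c := tcomm mul inv one (fun i => x (widen_ord (leqnSn n.+1) i)) in
  H c /\ pi c = tcomm mulQ invQ oneQ (phi x).
Proof.
have [[gG _] _ _] := cG; have [[gQ _] _ _] := cQ; have [_ H1 HD] := sH.
have [HV HM] := subgroup_closed gG H1 HD.
have [pi1 piV] := group_morphV gG gQ H1 HV piM.
move=> Sx; apply: lcomm_morph => // i; apply: Sx.
exact: (ltn_ord i).
Qed.

End quotient.

(* G compact group, H closed subgroup, K = H ∩ Z(G), n >= 1.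
   Q together with pi : H ->> Q (continuous surjective homomorphism with kernel K)
   is (a copy of) the compact quotient group H/K.
   muHG = Haar measure of H^(n+1) x G (inside G^(n+2)),
   muQ  = Haar measure of (H/K)^(n+1). *)
Theorem theorem3p2 (R : realType)
  (G : topologicalType) (mul : G -> G -> G) (inv : G -> G) (one : G)
  (H : set G)
  (Q : topologicalType) (mulQ : Q -> Q -> Q) (invQ : Q -> Q) (oneQ : Q)
  (pi : G -> Q) (n : nat)
  (muHG : set {ptws 'I_(n.+2) -> G} -> \bar R)
  (muQ : set {ptws 'I_(n.+1) -> Q} -> \bar R) :
  compact_group mul inv one ->
  closed_subgroup mul inv one H ->
  (1 <= n)%N ->
  compact_group mulQ invQ oneQ ->
  (forall x y, H x -> H y -> pi (mul x y) = mulQ (pi x) (pi y)) ->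
  {within H, continuous pi} ->
  (forall q, exists2 h, H h & pi h = q) ->
  (forall h, H h -> (pi h = oneQ <-> (H `&` group_center mul) h)) ->
  @haar_measure R {ptws 'I_(n.+2) -> G} (@tmul G mul n.+2)
    [set x | forall i : 'I_(n.+2), (i < n.+1)%N -> H (x i)] muHG ->
  @haar_measure R {ptws 'I_(n.+1) -> Q} (@tmul Q mulQ n.+1) setT muQ ->
  (muHG [set x | tcomm mul inv one x = one]
     <= 2^-1%:E * (1 + muQ [set y | tcomm mulQ invQ oneQ y = oneQ]))%E.
Proof.
move=> cG sH _ cQ piM pi_cont pi_surj piK muHGP muQP.
set S := [set x | _] in muHGP.
have [|bA half] := haar_comm_half cG muHGP.
  move=> g i lti; rewrite ifN; first by case: sH.
  by rewrite -val_eqE /= ltn_eqF.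
set A := [set x | _] in bA half.
have clC := closed_tcomm_eq1 (k := n.+1) cQ.
have le_C := haar_quotient_le cG sH cQ piM pi_cont pi_surj muHGP muQP clC.
have bS : borel (S : set {ptws 'I_n.+2 -> G}) :=
  borel_ptws_subgroup (n := n) sH.
have bSC := borel_quotient_closed sH pi_cont clC.
have mH := haar_content muHGP; have [_ _ _ _ mD] := mH.
(* On [S] the commutator lies in [H]; when central it is in the kernel of [pi]. *)
have /(content_le mH (borelI bA bS) bSC) le_SC : A `&` S `<=`
    S `&` (fun x : {ptws 'I_n.+2 -> G} => fun i : 'I_n.+1 =>
      pi (x (widen_ord (leqnSn n.+1) i))) @^-1`
    [set y | tcomm mulQ invQ oneQ y = oneQ].
  move=> x [Ax Sx]; split=> //.
  have [Hc pic] := tcomm_quotient cG sH cQ piM Sx.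
  by rewrite /preimage /mkset -pic; apply/piK.
(* [S] has full measure, so tuples outside it do not count. *)
have S0 : fine (muHG (A `\` S)) <= 0.
  rewrite (_ : 0 = fine (muHG (~` S))).
    by apply: (content_le mH); [exact: borelD|exact: borelC|move=> x []].
  rewrite -[RHS]/((fine \o muHG) (~` S)) (content_setC mH bS) /=.
  by case: muHGP => _ _ [-> ->] _ _; rewrite subrr.
have AS := mD A S bA bS.
rewrite (haar_fin muHGP (borel_closed (closed_tcomm_eq1 cG))).
rewrite (haar_fin muQP (borel_closed clC)) -EFinD -EFinM lee_fin.
apply: le_trans half _; move: AS le_C le_SC S0 => /=; lra.
Qed.
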